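(* Let $\epsilon_0>0$ and let $\{\Phi^\epsilon\}_{\epsilon\in[0,\epsilon_0]}$ be product cocycles on $\mathbb X=X\times P$. Assume that there exists $\epsilon_1\in(0,\epsilon_0]$ such that: (U1) for every $\epsilon\in[0,\epsilon_1]$, $\Phi^\epsilon$ has a $\mathfrak D$-pullback random attractor $\mathcal A^\epsilon$; (U2) the family $\mathcal C(\omega)=\overline{\bigcup_{\epsilon\in[0,\epsilon_1]}\mathcal A^\epsilon(\omega)}^{\,\mathbb X}$, $\omega\in\Omega$, belongs to $\mathfrak D$, and $\mathcal C(\omega)$ is compact for every $\omega\in\Omega$; (U3) for every $t\ge0$, $\omega\in\Omega$ and compact set $C\subset\mathbb X$, $$\sup_{z\in C}d_{\mathbb X}\big(\Phi^\epsilon(t,\omega)z,\Phi^0(t,\omega)z\big)\to0\qquad\text{as }\epsilon\to0.$$ Then, for every $\omega\in\Omega$, $$\operatorname{dist}_{\mathbb X}\big(\mathcal A^\epsilon(\omega),\mathcal A^0(\omega)\big)\to0\qquad\text{as }\epsilon\to0.$$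
   Context: $(\Omega,\mathcal F,\mathbb P,\{\theta_t\}_{t\in\mathbb R})$ is a metric dynamical system; all pathwise statements are understood on a fixed measurable $\theta_t$-invariant set of full probability, again denoted $\Omega$. $X$ is a separable Banach space; $\mathcal P_2(X)$ is the set of Borel probability measures on $X$ with finite second moment, with the 2-Wasserstein metric $\mathcal W_{2,X}$; $P$ is a complete separable metric subspace of $(\mathcal P_2(X),\mathcal W_{2,X})$; $\mathbb X=X\times P$ has metric $d_{\mathbb X}((x,\mu),(y,\nu))=\|x-y\|_X+\mathcal W_{2,X}(\mu,\nu)$. $\mathbb R^+=[0,\infty)$. A product cocycle is a map $\Phi(t,\omega)(x,\mu)=(\varphi_X(t,\omega,x,\mu),\varphi_P(t)\mu)$, $t\ge0$, where $\varphi_X:\mathbb R^+\times\Omega\times X\times P\to X$ and $\varphi_P:\mathbb R^+\times P\to P$ satisfy: (P1) $\varphi_X(0,\omega,x,\mu)=x$, $\varphi_P(0)\mu=\mu$; (P2) for $s,t\ge0$: $\varphi_X(t+s,\omega,x,\mu)=\varphi_X(t,\theta_s\omega,\varphi_X(s,\omega,x,\mu),\varphi_P(s)\mu)$ and $\varphi_P(t+s)\mu=\varphi_P(t)\varphi_P(s)\mu$; (P3) for all $t\ge0,\omega$, the map $(x,\mu)\mapsto(\varphi_X(t,\omega,x,\mu),\varphi_P(t)\mu)$ is continuous on $\mathbb X$; (P4) $\varphi_X$ is jointly measurable for $\mathcal B(\mathbb R^+)\otimes\mathcal F\otimes\mathcal B(X)\otimes\mathcal B(P)$ and $\varphi_P$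 is jointly Borel measurable. Universes: $\mathfrak D_X$ is an inclusion-closed collection of families $\{B_X(\omega)\}_{\omega\in\Omega}$ of nonempty subsets of $X$, $\mathfrak D_P$ an inclusion-closed collection of nonempty subsets of $P$ (inclusion closed: nonempty (families of) subsets of members are members). $\mathfrak D$ consists of all families $D=\{D(\omega)\}_{\omega\in\Omega}$ of nonempty subsets of $\mathbb X$ for which there are $B_X\in\mathfrak D_X$, $B_P\in\mathfrak D_P$ with $D(\omega)\subset B_X(\omega)\times B_P$ for all $\omega$. The universe $\mathfrak D$ does not depend on $\epsilon$. $\operatorname{dist}_{\mathbb X}(C_1,C_2)=\sup_{z\in C_1}\inf_{a\in C_2}d_{\mathbb X}(z,a)$ for nonempty $C_1,C_2\subset\mathbb X$. A random compact set is a family of nonempty compact sets $C(\omega)$ such that $\omega\mapsto\inf_{a\in C(\omega)}d_{\mathbb X}(z,a)$ is measurable for every $z\in\mathbb X$. A random compact set $\mathcal A$ is a $\mathfrak D$-pullback random attractor for $\Phi$ if $\mathcal A\in\mathfrak D$, $\Phi(t,\omega)\mathcal A(\omega)=\mathcal A(\theta_t\omega)$ for $t\ge0$, and $\lim_{t\to\infty}\operatorname{dist}_{\mathbb X}(\Phi(t,\theta_{-t}\omega)D(\theta_{-t}\omega),\mathcal A(\omega))=0$ for all $D\in\mathfrak D$, $\omega\in\Omega$. *)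

(* Defs.v *)
From HB Require Import structures.
From mathcomp Require Import all_boot all_order all_algebra.
From mathcomp Require Import all_classical all_reals all_analysis.
From mathcomp Require Import measurable_realfun.

Set Implicit Arguments.
Unset Strict Implicit.
Unset Printing Implicit Defensive.

Import Order.TTheory GRing.Theory Num.Theory.
Import numFieldNormedType.Exports.

Local Open Scope classical_set_scope.
Local Open Scope ring_scope.

#[short(type="completeMetricType")]
HB.structure Definition CompleteMetric (R : numDomainType) :=
  {T of Metric R T & Complete T}.

Definition separable (T : topologicalType) : Prop :=
  exists D : set T, countable D /\ dense D.

Definition borel (T : ptopologicalType) := g_sigma_algebraType (@open T).

Section Wasserstein.
Context {R : realType} {X : completeNormedModType R}.

Definition second_moment (mu : probability (borel X) R) : \bar R :=
  (\int[mu]_(x in setT) (`|x : X| ^+ 2)%:E)%E.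

Definition coupling (mu nu : probability (borel X) R) :
    set (probability (borel X * borel X)%type R) :=
  [set pi | forall A : set (borel X), measurable A ->
     pi (A `*` setT) = mu A /\ pi (setT `*` A) = nu A].

Definition wasserstein2 (mu nu : probability (borel X) R) : \bar R :=
  poweR (ereal_inf [set (\int[pi]_(z in setT) (`|(z.1 : X) - z.2| ^+ 2)%:E)%E
                   | pi in coupling mu nu]) 2^-1.

(* A metric subspace of the 2-Wasserstein space over X is given by a metric
   type P whose points are read, through [iota], as Borel probability measures
   with finite second moment, and whose distance is the Wasserstein distance.
   [iota] is automatically injective, since [mdist] separates points. *)
Record wasserstein_subspace (P : metricType R)
    (iota : P -> probability (borel X) R) : Prop := {
  ws_moment : forall mu, (second_moment (iota mu) < +oo)%E ;
  ws_mdist : forall mu nu, (mdist mu nu)%:E = wasserstein2 (iota mu) (iota nu)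
}.

End Wasserstein.

(* X * P with the sum metric; the alias keeps it apart from the uniform
   structure (max metric) that the library puts on products. *)
Definition phase {R : realType} (X : completeNormedModType R)
  (P : completeMetricType R) : Type := (X * P)%type.

Section PhaseMetric.
Context {R : realType} (X : completeNormedModType R)
  (P : completeMetricType R).

HB.instance Definition _ := Choice.copy (phase X P) (X * P)%type.

Definition phase_dist (z w : phase X P) : R :=
  `|z.1 - w.1| + mdist z.2 w.2.

Lemma phase_distxx z : phase_dist z z = 0.
Proof. by rewrite /phase_dist subrr normr0 mdistxx addr0. Qed.

Lemma phase_dist_positivity z w : phase_dist z w = 0 -> z = w.
Proof.
move: z w => [x mu] [y nu] /eqP.
rewrite /phase_dist /= paddr_eq0 ?normr_ge0 ?mdist_ge0 // normr_eq0 subr_eq0.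
by move=> /andP[/eqP -> /eqP /mdist_positivity ->].
Qed.

Lemma phase_dist_sym z w : phase_dist z w = phase_dist w z.
Proof. by rewrite /phase_dist distrC metric_sym. Qed.

Lemma phase_dist_triangle w z u :
  phase_dist z u <= phase_dist z w + phase_dist w u.
Proof.
by rewrite /phase_dist addrACA lerD ?ler_distD ?metric_triangle.
Qed.

HB.instance Definition _ := @isMetric.Build R (phase X P) phase_dist
  phase_distxx phase_dist_positivity phase_dist_sym phase_dist_triangle.

End PhaseMetric.

Section SetDistance.
Context {R : realType} {T : metricType R}.

Definition point_dist (z : T) (C : set T) : \bar R :=
  ereal_inf [set (mdist z a)%:E | a in C].

Definition semidist (C1 C2 : set T) : \bar R :=
  ereal_sup [set point_dist z C2 | z in C1].

Definition random_compact_set d (Omega : measurableType d)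
    (C : Omega -> set T) : Prop :=
  [/\ forall w, C w !=set0,
      forall w, compact (C w) &
      forall z, measurable_fun setT (fun w => point_dist z (C w))].

End SetDistance.

Section Dynamics.
Context {R : realType} d {Omega : measurableType d}.

Record metric_dynamical_system (Pr : probability Omega R)
    (theta : R -> Omega -> Omega) : Prop := {
  mds_measurable : measurable_fun setT
    (fun z : R * Omega => theta z.1 z.2) ;
  mds0 : forall w, theta 0 w = w ;
  mdsD : forall s t w, theta (s + t) w = theta s (theta t w) ;
  mds_preserving : forall t (A : set Omega),
    measurable A -> Pr (theta t @^-1` A) = Pr A
}.

Context {X : completeNormedModType R} {P : completeMetricType R}.

Definition cocycle_map (phiX : R -> Omega -> X -> P -> X) (phiP : R -> P -> P)
    (t : R) (w : Omega) (z : phase X P) : phase X P :=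
  (phiX t w z.1 z.2, phiP t z.2).

(* Time is a real number; the values of [phiX] and [phiP] at negative times
   are arbitrary and never constrained or used. *)
Record product_cocycle (theta : R -> Omega -> Omega)
    (phiX : R -> Omega -> X -> P -> X) (phiP : R -> P -> P) : Prop := {
  pc0_X : forall w x mu, phiX 0 w x mu = x ;
  pc0_P : forall mu, phiP 0 mu = mu ;
  pcD_X : forall s t w x mu, 0 <= s -> 0 <= t ->
    phiX (t + s) w x mu = phiX t (theta s w) (phiX s w x mu) (phiP s mu) ;
  pcD_P : forall s t mu, 0 <= s -> 0 <= t ->
    phiP (t + s) mu = phiP t (phiP s mu) ;
  pc_continuous : forall t w, 0 <= t -> continuous (cocycle_map phiX phiP t w) ;
  pc_measurable_X : measurable_fun
    [set z : R * Omega * borel X * borel P | 0 <= z.1.1.1]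
    (fun z => phiX z.1.1.1 z.1.1.2 z.1.2 z.2 : borel X) ;
  pc_measurable_P : measurable_fun
    [set z : R * borel P | 0 <= z.1]
    (fun z => phiP z.1 z.2 : borel P)
}.

Definition universe_X (DX : set (Omega -> set X)) : Prop :=
  (forall B, DX B -> forall w, B w !=set0) /\
  (forall B B', DX B -> (forall w, B' w !=set0) ->
    (forall w, B' w `<=` B w) -> DX B').

Definition universe_P (DP : set (set P)) : Prop :=
  (forall B, DP B -> B !=set0) /\
  (forall B B', DP B -> B' !=set0 -> B' `<=` B -> DP B').

Definition product_universe (DX : set (Omega -> set X)) (DP : set (set P)) :
    set (Omega -> set (phase X P)) :=
  [set D | (forall w, D w !=set0) /\
     exists BX BP, [/\ DX BX, DP BP & forall w, D w `<=` BX w `*` BP]].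

Definition pullback_random_attractor (theta : R -> Omega -> Omega)
    (Phi : R -> Omega -> phase X P -> phase X P)
    (DD : set (Omega -> set (phase X P))) (A : Omega -> set (phase X P)) : Prop :=
  [/\ random_compact_set A,
      DD A,
      forall t w, 0 <= t -> Phi t w @` A w = A (theta t w) &
      forall D w, DD D ->
        semidist (Phi t (theta (- t) w) @` D (theta (- t) w)) (A w)
          @[t --> +oo%R] --> 0%E].

End Dynamics.

(* Main.v *)
Require Import Defs.
From HB Require Import structures.
From mathcomp Require Import all_boot all_order all_algebra.
From mathcomp Require Import all_classical all_reals all_analysis.
From mathcomp Require Import measurable_realfun.

Import Order.TTheory GRing.Theory Num.Theory.
Import numFieldNormedType.Exports.

Local Open Scope classical_set_scope.
Local Open Scope ring_scope.

(** All the attractors lie in one family of compact sets that is itself pullback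
    attracted by [A^0]; this trades the large-time attraction under the
    unperturbed cocycle for a finite-time comparison.  Let [C] be the closure of
    the union of the attractors.  Given [e > 0], since [C] is in the universe,
    [Phi^0] pulls [C] from some single time [- t] into the [e/2]-neighbourhood
    of [A^0(w)].  With [t] now fixed, [Phi^eps(t)] and [Phi^0(t)] are uniformly
    [e/2]-close on the compact set [C(theta_(-t) w)] once [eps] is small.
    Invariance gives [A^eps(w) = Phi^eps(t) A^eps(theta_(-t) w)], which lies in
    [Phi^eps(t) C(theta_(-t) w)], hence
    [dist (A^eps(w), A^0(w)) < e/2 + e/2].  The metric content of this estimate
    is [semidist_image_le]; [ge0_lt_cvge0] turns it into the convergence. *)

Lemma cvge0_lt {R : realType} {I : Type} {F : set_system I} {FF : Filter F}
    {f : I -> \bar R} {e : R} :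
  f @ F --> 0%E -> 0 < e -> \forall i \near F, (f i < e%:E)%E.
Proof.
move=> f0 e_gt0; apply: (f0 [set x | (x < e%:E)%E]).
by apply: open_ereal_lt'; rewrite lte_fin.
Qed.

(** One-sided estimates suffice: nonnegativity bounds [f] from below, and the
    estimate for a single [e] already forces finite values. *)
Lemma ge0_lt_cvge0 {R : realType} {I : Type} {F : set_system I}
    {FF : Filter F} {f : I -> \bar R} :
  (\forall i \near F, (0 <= f i)%E) ->
  (forall e : R, 0 < e -> \forall i \near F, (f i < e%:E)%E) ->
  f @ F --> 0%E.
Proof.
move=> f_ge0 f_lt.
apply/fine_cvgP; split.
  near=> i.
  have fi_ge0 : (0 <= f i)%E by near: i.
  have fi_lt1 : (f i < 1%:E)%E by near: i; exact: f_lt.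
  by rewrite ge0_fin_numE // (lt_trans fi_lt1) ?ltry.
apply/cvgr0Pnorm_lt => e e_gt0; near=> i.
have fi_ge0 : (0 <= f i)%E by near: i.
have fi_lte : (f i < e%:E)%E by near: i; exact: f_lt.
have fi_fin : f i \is a fin_num.
  by rewrite ge0_fin_numE // (lt_trans fi_lte) ?ltry.
by rewrite /= ger0_norm ?fine_ge0 // -lte_fin fineK.
Unshelve. all: by end_near. Qed.

Lemma point_dist_ge0 {R : realType} {T : metricType R} (z : T) (C : set T) :
  (0 <= point_dist z C)%E.
Proof. by apply: le_ereal_inf_tmp => _ [a _ <-]; rewrite lee_fin mdist_ge0. Qed.

Lemma point_dist_triangle {R : realType} {T : metricType R} (z y : T)
  (C : set T) : (point_dist z C <= (mdist z y)%:E + point_dist y C)%E.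
Proof.
rewrite -leeBlDl //; apply: le_ereal_inf_tmp => _ [a Ca <-].
rewrite leeBlDl //; apply: le_trans (_ : ((mdist z a)%:E <= _)%E).
  by apply: ereal_inf_lbound; exists a.
by rewrite -EFinD lee_fin metric_triangle.
Qed.

Lemma semidist_ge0 {R : realType} {T : metricType R} {B : set T}
  (C : set T) : B !=set0 -> (0 <= semidist B C)%E.
Proof.
case=> z Bz; apply: le_trans (point_dist_ge0 z C) _.
by apply: ereal_sup_ubound; exists z.
Qed.

Lemma semidist_subl {R : realType} {T : metricType R} {B B' : set T}
  (C : set T) :
  B `<=` B' -> (semidist B C <= semidist B' C)%E.
Proof. by move=> BB'; apply: le_ereal_sup; apply: image_subset. Qed.

(** The distance to [C] is 1-Lipschitz, so exchanging [g] for [f] moves each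
    point of the image by an amount that the supremum controls.  Extended reals
    allow for an infinite supremum or an empty set. *)
Lemma semidist_image_le {R : realType} {S : Type} {T : metricType R}
    (f g : S -> T) (B : set S) (C : set T) :
  (semidist (f @` B) C <=
   ereal_sup [set (mdist (f z) (g z))%:E | z in B] + semidist (g @` B) C)%E.
Proof.
apply: ge_ereal_sup => _ [_ [z Bz <-] <-].
apply: le_trans (point_dist_triangle _ (g z) _) _.
apply: leeD; apply: ereal_sup_ubound; first by exists z.
by exists (g z) => //; exists z.
Qed.

Theorem theorem2p10 (R : realType)
  (d : measure_display) (Omega : measurableType d) (Pr : probability Omega R)
  (theta : R -> Omega -> Omega)
  (theta_mds : metric_dynamical_system Pr theta)
  (X : completeNormedModType R) (X_separable : separable X)
  (P : completeMetricType R) (P_separable : separable P)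
  (iota : P -> probability (borel X) R)
  (P_wasserstein : wasserstein_subspace iota)
  (DX : set (Omega -> set X)) (DX_universe : universe_X DX)
  (DP : set (set P)) (DP_universe : universe_P DP)
  (eps0 : R) (eps0_gt0 : 0 < eps0)
  (phiX : R -> R -> Omega -> X -> P -> X) (phiP : R -> R -> P -> P)
  (Phi_cocycle : forall eps, 0 <= eps <= eps0 ->
     product_cocycle theta (phiX eps) (phiP eps))
  (eps1 : R) (eps1_range : 0 < eps1 <= eps0)
  (A : R -> Omega -> set (phase X P))
  (U1 : forall eps, 0 <= eps <= eps1 ->
     pullback_random_attractor theta (cocycle_map (phiX eps) (phiP eps))
       (product_universe DX DP) (A eps))
  (U2 : let C := fun w =>
          closure (\bigcup_(eps in [set e : R | 0 <= e <= eps1]) A eps w) in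
        product_universe DX DP C /\ forall w, compact (C w))
  (U3 : forall t w (C : set (phase X P)), 0 <= t -> compact C -> C !=set0 ->
     ereal_sup [set (mdist (cocycle_map (phiX eps) (phiP eps) t w z)
                           (cocycle_map (phiX 0) (phiP 0) t w z))%:E | z in C]
       @[eps --> 0^'+] --> 0%E) :
  forall w, semidist (A eps w) (A 0 w) @[eps --> 0^'+] --> 0%E.
Proof.
case: U2 => /=; set C := fun w => closure _ => DC C_compact w.
have [C_neq0 _] := DC.
pose Phi eps := cocycle_map (phiX eps) (phiP eps).
have [eps1_gt0 _] := andP eps1_range.
have A_sub_C eps v : 0 <= eps <= eps1 -> A eps v `<=` C v.
  by move=> eps_range; apply: subset_trans (@subset_closure _ _);
    exact: bigcup_sup.
have eps_small : \forall eps \near 0^'+, 0 <= eps <= eps1.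
  near=> eps; apply/andP; split; near: eps; first exact: nbhs_right_ge.
  exact: nbhs_right_le.
apply: ge0_lt_cvge0 => [|e e_gt0].
  apply: filterS eps_small => eps /U1[[A_neq0 _ _] _ _ _].
  exact: semidist_ge0.
have e2_gt0 : 0 < e / 2 by rewrite divr_gt0.
(* The attraction time is chosen before [eps]: it depends on [Phi^0] and [C]
   alone. *)
have [t [t_ge0 attracted]] : exists t : R, 0 <= t /\
    (semidist (Phi 0%R t (theta (- t)%R w) @` C (theta (- t)%R w)) (A 0%R w)
      < (e / 2)%:E)%E.
  have [_ _ _ /(_ C w DC) attraction] : pullback_random_attractor theta (Phi 0)
      (product_universe DX DP) (A 0).
    by apply: U1; rewrite lexx ltW.
  apply: (@filter_ex _ +oo).
  apply: filterI; last exact: cvge0_lt attraction e2_gt0.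
  exact: nbhs_pinfty_ge (num_real 0).
set w' := theta (- t) w in attracted.
have theta_w' : theta t w' = w.
  by rewrite /w' -(mdsD theta_mds) subrr (mds0 theta_mds).
have close : \forall eps \near 0^'+,
    (ereal_sup [set (mdist (Phi eps t w' z) (Phi 0%R t w' z))%:E
               | z in C w'] < (e / 2)%:E)%E.
  exact: cvge0_lt (U3 t w' _ t_ge0 (C_compact w') (C_neq0 w')) e2_gt0.
apply: filterS2 eps_small close => eps eps_range close_eps.
have [_ _ invariant _] := U1 eps eps_range.
rewrite -[w in A eps w]theta_w' -(invariant t w' t_ge0).
apply: le_lt_trans (semidist_subl _ (image_subset _ (A_sub_C eps w' eps_range))) _.
apply: le_lt_trans (semidist_image_le _ (Phi 0%R t w') _ _) _.
by rewrite [e]splitr EFinD lteD.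
Unshelve. all: by end_near. Qed.
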